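(* Let $m\ge 3$, $n\ge 2$, and let $\Psi$ be an $m$-order $n$-dimensional symmetric complex tensor. Then there exists a real symmetric $m$-order $2n$-dimensional tensor $\mathcal{T}$ such that a number $\lambda$ is a Q-eigenvalue of $\Psi$ if and only if it is a Z-eigenvalue of $\mathcal{T}$. In this case, for $x,y\in\mathbb{R}^n$, $z=x+y\sqrt{-1}$ is a Q-eigenvector of $\Psi$ associated with $\lambda$ if and only if $w=\binom{x}{y}\in\mathbb{R}^{2n}$ is a Z-eigenvector of $\mathcal{T}$ associated with $\lambda$. Furthermore, the E-eigenvalues and the Z-eigenvalues of $\mathcal{T}$ appear in pairs: if $\lambda$ is an E-eigenvalue of $\mathcal{T}$, then $-\lambda$ is also an E-eigenvalue of $\mathcal{T}$; and if $\lambda$ is a Z-eigenvalue of $\mathcal{T}$, then $-\lambda$ is also a Z-eigenvalue of $\mathcal{T}$.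
   Context: An $m$-order $N$-dimensional complex tensor is an array $\mathcal{S}=(\mathcal{S}_{i_1\cdots i_m})$ with $\mathcal{S}_{i_1\cdots i_m}\in\mathbb{C}$ for $i_1,\dots,i_m\in\{1,\dots,N\}$; it is symmetric if its entries are invariant under any permutation of the indices. For $w\in\mathbb{C}^N$, $\mathcal{S}w^{m-1}\in\mathbb{C}^N$ is the vector with $i$th component $(\mathcal{S}w^{m-1})_i=\sum_{i_2,\dots,i_m=1}^N\mathcal{S}_{ii_2\cdots i_m}w_{i_2}\cdots w_{i_m}$. A bar denotes (entrywise) complex conjugation. E-eigenvalue: $\lambda\in\mathbb{C}$ is an E-eigenvalue of $\mathcal{S}$ with E-eigenvector $w\in\mathbb{C}^N$ if $\mathcal{S}w^{m-1}=\lambda w$ and $w^\top w=1$ (no conjugation). If $\mathcal{S}$ and $w$ are real, then $\lambda$ is real and is called a Z-eigenvalue of $\mathcal{S}$ with Z-eigenvector $w$. Q-eigenvalue (quantum eigenvalue): $\lambda$ is a Q-eigenvalue of the symmetric $m$-order $n$-dimensional tensor $\Psi$, with Q-eigenvector $z\in\mathbb{C}^n$, if $\Psi z^{m-1}=\lambda\bar z$, $\bar\Psi\bar z^{m-1}=\lambda z$ and $\bar z^\top z=1$. Such $\lambda$ is necessarily real; equivalently, $\lambda\in\mathbb{R}$, $\Psi z^{m-1}=\lambda\bar z$ and $\bar z^\top z=1$. *)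

(* Defs.v *)
From HB Require Import structures.
From mathcomp Require Import all_boot all_order all_algebra all_fingroup.
From mathcomp Require Import complex.
From mathcomp Require Import reals.

Set Implicit Arguments.
Unset Strict Implicit.
Unset Printing Implicit Defensive.

Import Order.TTheory GRing.Theory Num.Theory.
Local Open Scope ring_scope.
Local Open Scope complex_scope.

Definition tensor (K : Type) (m N : nat) : Type := {ffun m.-tuple 'I_N -> K}.

Definition symmetric_tensor (K : Type) (m N : nat) (S : tensor K m N) : Prop :=
  forall (s : 'S_m) (t : m.-tuple 'I_N), S [tuple tnth t (s k) | k < m] = S t.

Definition map_tensor (K L : Type) (m N : nat) (f : K -> L) (S : tensor K m N) :
  tensor L m N := [ffun t => f (S t)].

(* The vector S w^(m-1). The index (i, i_2, ..., i_m) ranges over the m-tuples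
   with first component i; for m = 0 there are none and the result is 0. *)
Definition tensor_apply (K : comNzRingType) (m N : nat) (S : tensor K m N)
    (w : 'cV[K]_N) : 'cV[K]_N :=
  \col_i \sum_(t : m.-tuple 'I_N | ohead t == Some i)
           S t * \prod_(j <- behead t) w j 0.

Section Eigenpairs.
Variables (R : realType) (m : nat).

Definition E_eigenpair (N : nat) (S : tensor R[i] m N) (lam : R[i])
    (w : 'cV[R[i]]_N) : Prop :=
  tensor_apply S w = lam *: w /\ w^T *m w = 1%:M.

Definition E_eigenvalue (N : nat) (S : tensor R[i] m N) (lam : R[i]) : Prop :=
  exists w : 'cV[R[i]]_N, E_eigenpair S lam w.

Definition complexify (N : nat) (T : tensor R m N) : tensor R[i] m N :=
  map_tensor (real_complex R) T.

(* [lam] is a priori complex; that it is real is a consequence of [T] and [w]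
   being real, and not part of the definition. *)
Definition Z_eigenpair (N : nat) (T : tensor R m N) (lam : R[i])
    (w : 'cV[R]_N) : Prop :=
  E_eigenpair (complexify T) lam (map_mx (real_complex R) w).

Definition Z_eigenvalue (N : nat) (T : tensor R m N) (lam : R[i]) : Prop :=
  exists w : 'cV[R]_N, Z_eigenpair T lam w.

(* As for [Z_eigenpair], [lam] is not assumed to be real. *)
Definition Q_eigenpair (n : nat) (Psi : tensor R[i] m n) (lam : R[i])
    (z : 'cV[R[i]]_n) : Prop :=
  [/\ tensor_apply Psi z = lam *: map_mx (@conjc R) z,
      tensor_apply (map_tensor (@conjc R) Psi) (map_mx (@conjc R) z) = lam *: z
    & (map_mx (@conjc R) z)^T *m z = 1%:M].

Definition Q_eigenvalue (n : nat) (Psi : tensor R[i] m n) (lam : R[i]) : Prop :=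
  exists z : 'cV[R[i]]_n, Q_eigenpair Psi lam z.

Definition complex_col (n : nat) (x y : 'cV[R]_n) : 'cV[R[i]]_n :=
  \col_k (x k 0 +i* y k 0).

End Eigenpairs.

(* Main.v *)
(** Write [w = (x, y)], [u = x + iy], [v = x - iy]. Let [T] be the symmetric
    tensor of the real-valued form [Re (Psi z^m)] in the [2n] real variables
    [(x, y)]. Complexified, [T] is half the sum of the pullbacks of [Psi] along
    [u] and of its conjugate along [v], so for every complex [w] the equations
    [T w^(m-1) = lam w], [w^T w = 1] are equivalent to
    [Psi u^(m-1) = lam v], [conj Psi v^(m-1) = lam u], [v^T u = 1].
    For real [w] this is the Q-eigenpair system of [z = u]. The system is mapped
    to the one for [- lam] by [(u, v) |-> (c u, c^-1 v)] where [c ^ m = -1], and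
    this keeps [v = conj u] since then [c] has modulus [1]. *)
Require Import Defs.
From mathcomp Require Import all_boot all_order all_algebra.
From mathcomp Require Import all_fingroup.
From mathcomp Require Import ring.
From mathcomp Require Import complex.
From mathcomp Require Import reals.
Set Implicit Arguments.
Unset Strict Implicit.
Unset Printing Implicit Defensive.
Import Order.TTheory GRing.Theory Num.Theory.
Local Open Scope ring_scope.
Local Open Scope complex_scope.

(** * Contraction of tensors and pullback along a linear map *)

Lemma big_tuple_cons (V : nmodType) (I : finType) (m : nat)
    (F : m.+1.-tuple I -> V) :
  \sum_t F t = \sum_(k : I) \sum_(t : m.-tuple I) F (cons_tuple k t).
Proof.
rewrite pair_big /= (reindex (fun p : I * m.-tuple I => cons_tuple p.1 p.2)) //=.
exists (fun t => (thead t, behead_tuple t)) => [[k t] _|t _] /=.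
  by congr (_, _); apply: val_inj.
by rewrite [RHS]tuple_eta.
Qed.

Section Tensors.
Variable K : comNzRingType.

Lemma tensor_applyE (m N : nat) (S : tensor K m.+1 N) (w : 'cV[K]_N) (i : 'I_N) :
  tensor_apply S w i 0 =
  \sum_(t : m.-tuple 'I_N) S (cons_tuple i t) * \prod_(j <- t) w j 0.
Proof.
rewrite mxE big_mkcond big_tuple_cons (bigD1 i) //= [X in _ + X]big1 => [|k nki].
  by rewrite addr0; apply: eq_bigr => t _; rewrite eqxx.
by apply: big1 => t _; case: eqP => // -[] /eqP; rewrite (negPf nki).
Qed.

Lemma tensor_applyZ (m N : nat) (S : tensor K m N) (c : K) (w : 'cV[K]_N) :
  tensor_apply S (c *: w) = c ^+ m.-1 *: tensor_apply S w.
Proof.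
apply/colP => i; rewrite !mxE mulr_sumr; apply: eq_bigr => t _.
under eq_bigr do rewrite mxE.
rewrite big_split /= big_const_seq count_predT size_behead size_tuple.
by rewrite iter_mulr_1 mulrCA.
Qed.

(** Distributivity, by induction on [m]: grouping the first index by its image under [p] splits off
    one inner sum. It moves the relabelling from the tensor to the vector it is contracted with. *)
Lemma sum_tuple_map (I J : finType) (p : I -> J) (h : I -> K) (m : nat)
    (F : m.-tuple J -> K) :
  \sum_(t : m.-tuple I) F (map_tuple p t) * \prod_(k <- t) h k =
  \sum_(s : m.-tuple J) F s * \prod_(j <- s) \sum_(k | p k == j) h k.
Proof.
elim: m F => [|m IHm] F.
  have sum0 (L : finType) (G : 0.-tuple L -> K) : \sum_t G t = G [tuple].
    by apply: big_pred1 => t; apply/esym/eqP; exact: tuple0.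
  by rewrite !sum0 !big_nil; congr (F _ * _); apply: val_inj.
rewrite !big_tuple_cons (partition_big p xpredT) //=; apply: eq_bigr => j _.
transitivity (\sum_(k | p k == j) h k *
  \sum_(s : m.-tuple J) F (cons_tuple j s) *
    \prod_(j' <- s) \sum_(k | p k == j') h k).
  apply: eq_bigr => k /eqP <-.
  rewrite -(IHm (fun s => F (cons_tuple (p k) s))) mulr_sumr.
  apply: eq_bigr => t _; rewrite big_cons mulrCA.
  by congr (_ * (F _ * _)); apply: val_inj.
rewrite -mulr_suml mulr_sumr; apply: eq_bigr => s _.
by rewrite big_cons mulrCA.
Qed.

(** The tensor of the form [S (L w)^m], where [L] is the linear map
    [(L w)_j = \sum_(k | p k == j) g k * w_k]. A column of [L] has at most one nonzero entry, so
    each entry here is a single product. *)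
Definition pullback (m n N : nat) (p : 'I_N -> 'I_n) (g : 'I_N -> K)
    (S : tensor K m n) : tensor K m N :=
  [ffun t => S (map_tuple p t) * \prod_(k <- t) g k].

Lemma symmetric_pullback (m n N : nat) (p : 'I_N -> 'I_n) (g : 'I_N -> K)
    (S : tensor K m n) :
  symmetric_tensor S -> symmetric_tensor (pullback p g S).
Proof.
move=> symS s t; rewrite !ffunE; congr (_ * _).
  rewrite -(symS s (map_tuple p t)); congr (S _).
  by apply: eq_from_tnth => k; rewrite tnth_map !tnth_mktuple tnth_map.
rewrite !big_tuple [RHS](reindex_inj (@perm_inj _ s)) /=.
by apply: eq_bigr => k _; rewrite tnth_mktuple.
Qed.

(** The shape of a chain rule: the transpose of [L] acts on the contraction of [S] with [L w]. It is
    [sum_tuple_map] with the first index kept apart. *)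
Lemma tensor_apply_pullback (m n N : nat) (p : 'I_N -> 'I_n) (g : 'I_N -> K)
    (S : tensor K m.+1 n) (w : 'cV[K]_N) (i : 'I_N) :
  tensor_apply (pullback p g S) w i 0 =
  g i * tensor_apply S (\col_j \sum_(k | p k == j) g k * w k 0) (p i) 0.
Proof.
rewrite !tensor_applyE.
under [in RHS]eq_bigr do under eq_bigr do rewrite mxE.
rewrite -(sum_tuple_map p (fun k => g k * w k 0)
           (fun s => S (cons_tuple (p i) s))) mulr_sumr.
apply: eq_bigr => t _; rewrite ffunE big_cons big_split /= mulrCA -!mulrA.
by congr (_ * (S _ * _)); apply: val_inj.
Qed.

End Tensors.

(** * The real tensor and its E-eigenpairs *)

Section Realification.
Variable R : realType.

Definition base_index (n : nat) (k : 'I_(n + n)) : 'I_n :=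
  match split k with inl j => j | inr j => j end.

(* [split k] is read as a boolean, true on the block of [x] in [(x, y)]. *)
Definition unit_weight (n : nat) (a : R[i]) (k : 'I_(n + n)) : R[i] :=
  if split k then 1 else a.

Definition realify (m n : nat) (Psi : tensor R[i] m n) : tensor R m (n + n) :=
  map_tensor (@complex.Re R) (pullback (@base_index n) (unit_weight 'i) Psi).

Definition conj_tensor (m n : nat) (Psi : tensor R[i] m n) : tensor R[i] m n :=
  map_tensor (@conjc R) Psi.

Lemma symmetric_realify (m n : nat) (Psi : tensor R[i] m n) :
  symmetric_tensor Psi -> symmetric_tensor (realify Psi).
Proof.
move=> symP s t; rewrite !ffunE.
have := symmetric_pullback (@base_index n) (unit_weight 'i) symP s t.
by rewrite !ffunE => ->.
Qed.

(** [base_index] takes each value [j] exactly twice, once in each block. *)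
Lemma sum_base_index (n : nat) (a : R[i]) (x y : 'cV[R[i]]_n) :
  \col_j \sum_(k | base_index k == j) unit_weight a k * col_mx x y k 0 =
  x + a *: y.
Proof.
apply/colP => j; rewrite !mxE big_split_ord /=; congr (_ + _).
  rewrite (big_pred1 j) => [|k]; last first.
    by rewrite /base_index (unsplitK (inl _ k)).
  by rewrite /unit_weight (unsplitK (inl _ j)) mul1r col_mxEu.
rewrite (big_pred1 j) => [|k]; last first.
  by rewrite /base_index (unsplitK (inr _ k)).
by rewrite /unit_weight (unsplitK (inr _ j)) col_mxEd.
Qed.

Lemma complex_Re_half_sum (a : R[i]) : (complex.Re a)%:C = 2^-1 * (a + a^*).
Proof.
have -> : a + a^* = 2 * (complex.Re a)%:C.
  case: a => a b /=; rewrite mulr_natl mulr2n.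
  by apply/eqP; rewrite eq_complex /= subrr addr0 !eqxx.
by rewrite mulKf // pnatr_eq0.
Qed.

(** Used with [j = 'i] for two purposes: to decouple the two blocks of the eigenvalue equation, and
    to recover [(x, y)] from [(v, u)]. *)
Lemma half_sum_diff (j a b p q : R[i]) :
  j * j = -1 ->
  (2^-1 * (a + b) = p /\ 2^-1 * (j * (a - b)) = q) <->
  (a = p - j * q /\ b = p + j * q).
Proof.
have n2 : (2 : R[i]) != 0 by rewrite pnatr_eq0.
move=> jj; split=> [[<- <-]|[-> ->]].
  have -> : j * (2^-1 * (j * (a - b))) = j * j * (2^-1 * (a - b)) by ring.
  by rewrite jj; split; field.
have -> : j * (p - j * q - (p + j * q)) = - (j * j) * (2 * q) by ring.
by rewrite jj; split; field.
Qed.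

Lemma conj_weight (n : nat) (k : 'I_(n + n)) :
  (unit_weight 'i k)^* = unit_weight (- 'i) k.
Proof.
rewrite /unit_weight; case: (split k) => ? /=; last first.
  by apply/eqP; rewrite eq_complex /= oppr0 !eqxx.
exact: conjc1.
Qed.

(** A real part is half the sum with the conjugate, and conjugating a pullback conjugates both
    tensor and weights. As [x] and [y] are complex, [x - 'i *: y] need not be the conjugate of
    [x + 'i *: y]. *)
Lemma tensor_apply_realify (m n : nat) (Psi : tensor R[i] m.+1 n)
    (x y : 'cV[R[i]]_n) (i : 'I_(n + n)) :
  tensor_apply (complexify (realify Psi)) (col_mx x y) i 0 =
  2^-1 * (unit_weight 'i i * tensor_apply Psi (x + 'i *: y) (base_index i) 0 +
          unit_weight (- 'i) i *
            tensor_apply (conj_tensor Psi) (x - 'i *: y) (base_index i) 0).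
Proof.
rewrite -scaleNr -!sum_base_index -!tensor_apply_pullback !tensor_applyE.
rewrite -big_split mulr_sumr; apply: eq_bigr => t _ /=.
rewrite !ffunE complex_Re_half_sum rmorphM rmorph_prod /=.
rewrite [X in _ + _ * X](eq_bigr (unit_weight (- (0 +i* 1)))) => [|k _];
  last exact: conj_weight.
by rewrite -[LHS]mulrA; congr (_ * _); exact: mulrDl.
Qed.

(** The Q-eigenpair system with the conjugate of [z] replaced by an independent vector [v], so that
    it also describes complex E-eigenvectors. *)
Definition paired_eigen (m n : nat) (Psi : tensor R[i] m n) (lam : R[i])
    (u v : 'cV[R[i]]_n) : Prop :=
  [/\ tensor_apply Psi u = lam *: v,
      tensor_apply (conj_tensor Psi) v = lam *: u & v^T *m u = 1%:M].

Lemma E_eigenpair_realify (m n : nat) (Psi : tensor R[i] m.+1 n) (lam : R[i])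
    (x y : 'cV[R[i]]_n) :
  E_eigenpair (complexify (realify Psi)) lam (col_mx x y) <->
  paired_eigen Psi lam (x + 'i *: y) (x - 'i *: y).
Proof.
have ii : 'i * 'i = -1 :> R[i] by rewrite -expr2 sqr_i.
have norm_eq : (col_mx x y)^T *m col_mx x y = (x - 'i *: y)^T *m (x + 'i *: y).
  rewrite tr_col_mx mul_row_col linearB linearZ /= mulmxBl !mulmxDr.
  rewrite -!scalemxAr -!scalemxAl scalerA ii scaleN1r.
  (* The cross terms cancel, since a 1 by 1 matrix is its own transpose. *)
  have -> : y^T *m x = x^T *m y.
    by rewrite [RHS]mx11_scalar -tr_scalar_mx -mx11_scalar trmx_mul trmxK.
  by rewrite opprB addrACA subrr addr0.
rewrite /E_eigenpair /paired_eigen norm_eq.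
set u := x + 'i *: y; set v := x - 'i *: y.
set A := tensor_apply Psi u; set B := tensor_apply _ v.
have applyl j :
    tensor_apply (complexify (realify Psi)) (col_mx x y) (lshift n j) 0 =
    2^-1 * (A j 0 + B j 0).
  rewrite tensor_apply_realify /base_index /unit_weight (unsplitK (inl _ j)).
  by rewrite !mul1r.
have applyr j :
    tensor_apply (complexify (realify Psi)) (col_mx x y) (rshift n j) 0 =
    2^-1 * ('i * (A j 0 - B j 0)).
  rewrite tensor_apply_realify /base_index /unit_weight (unsplitK (inr _ j)).
  by rewrite mulNr -mulrBr.
(* Solving for [A] and [B] brings in [- 'i], the inverse of ['i]; hence [A], built from [u], is
   matched with [v], and [B] with [u]. *)
have entry : tensor_apply (complexify (realify Psi)) (col_mx x y) =
             lam *: col_mx x y <->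
    forall j, A j 0 = lam * v j 0 /\ B j 0 = lam * u j 0.
  have vE j : lam * v j 0 = lam * x j 0 - 'i * (lam * y j 0).
    by rewrite !mxE; ring.
  have uE j : lam * u j 0 = lam * x j 0 + 'i * (lam * y j 0).
    by rewrite !mxE; ring.
  split=> [eqT j | eqAB].
    rewrite vE uE; apply/(half_sum_diff _ _ _ _ ii); rewrite -applyl -applyr eqT.
    by split; rewrite mxE ?col_mxEu ?col_mxEd.
  apply/colP => i; rewrite -(splitK i) [RHS]mxE; case: (split i) => j /=;
    have := eqAB j; rewrite vE uE => /(half_sum_diff _ _ _ _ ii)[eql eqr].
    by rewrite applyl col_mxEu.
  by rewrite applyr col_mxEd.
split=> [[/entry eqAB ->]|[eqA eqB ->]]; split=> //.
- by apply/colP => j; rewrite [RHS]mxE; case: (eqAB j).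
- by apply/colP => j; rewrite [RHS]mxE; case: (eqAB j).
by apply/entry => j; rewrite eqA eqB !mxE.
Qed.

(** Contraction is homogeneous of degree [m] and [c ^+ m = - c^-1], which supplies both the sign and
    the scaling of the other vector. The inverse scalings cancel in [v^T *m u]. *)
Lemma paired_eigen_opp (m n : nat) (Psi : tensor R[i] m.+1 n) (lam c : R[i])
    (u v : 'cV[R[i]]_n) :
  c ^+ m.+1 = -1 -> paired_eigen Psi lam u v ->
  paired_eigen Psi (- lam) (c *: u) (c^-1 *: v).
Proof.
move=> cX [eqA eqB eq1].
have c0 : c != 0.
  by apply/eqP => c0; move/eqP: cX; rewrite c0 expr0n eq_sym oppr_eq0 oner_eq0.
have cXm : c ^+ m = - c^-1.
  by apply: (mulfI c0); rewrite -exprS cX mulrN divff.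
split.
- by rewrite tensor_applyZ cXm eqA !scalerA mulrC mulrN mulNr.
- rewrite tensor_applyZ exprVn cXm eqB !scalerA invrN invrK.
  by rewrite mulrC mulrN mulNr.
by rewrite !linearZ /= -scalemxAl scalerA divff // scale1r.
Qed.

(** Lets a rescaled pair [(u, v)] be read again as a complex vector of dimension [n + n]. *)
Lemma paired_coordinates (n : nat) (u v : 'cV[R[i]]_n) :
  exists x y, u = x + 'i *: y /\ v = x - 'i *: y.
Proof.
exists (2^-1 *: (v + u)), (2^-1 *: ('i *: (v - u))).
have ii : 'i * 'i = -1 :> R[i] by rewrite -expr2 sqr_i.
suff uv k :
    u k 0 = 2^-1 * (v k 0 + u k 0) + 'i * (2^-1 * ('i * (v k 0 - u k 0))) /\
    v k 0 = 2^-1 * (v k 0 + u k 0) - 'i * (2^-1 * ('i * (v k 0 - u k 0))).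
  by split; apply/colP => k; have [uE vE] := uv k; rewrite !mxE.
exact/and_comm/(half_sum_diff _ _ _ _ ii).
Qed.

(** * Real vectors and Q-eigenpairs *)

Lemma complex_colE (n : nat) (x y : 'cV[R]_n) :
  complex_col x y =
  map_mx (real_complex R) x + 'i *: map_mx (real_complex R) y.
Proof. by apply/colP => k; rewrite !mxE [LHS]complexE. Qed.

Lemma conj_complex_col (n : nat) (x y : 'cV[R]_n) :
  map_mx (@conjc R) (complex_col x y) =
  map_mx (real_complex R) x - 'i *: map_mx (real_complex R) y.
Proof. by apply/colP => k; rewrite !mxE; simpc. Qed.

Lemma complex_colP (n : nat) (z : 'cV[R[i]]_n) :
  exists x y : 'cV[R]_n, z = complex_col x y.
Proof.
exists (map_mx (@complex.Re R) z), (map_mx (@complex.Im R) z).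
by apply/colP => k; rewrite !mxE; case: (z k 0).
Qed.

Lemma Z_eigenpair_realify (m n : nat) (Psi : tensor R[i] m.+1 n) (lam : R[i])
    (x y : 'cV[R]_n) :
  Q_eigenpair Psi lam (complex_col x y) <->
  Z_eigenpair (realify Psi) lam (col_mx x y).
Proof.
rewrite /Z_eigenpair map_col_mx E_eigenpair_realify.
by rewrite -conj_complex_col -complex_colE.
Qed.

Lemma Q_eigenvalue_realify (m n : nat) (Psi : tensor R[i] m.+1 n) (lam : R[i]) :
  Q_eigenvalue Psi lam <-> Z_eigenvalue (realify Psi) lam.
Proof.
split=> [[z]|[w]].
  have [x [y ->]] := complex_colP z.
  by move/Z_eigenpair_realify; exists (col_mx x y).
rewrite -[w]vsubmxK => /Z_eigenpair_realify.
by exists (complex_col (usubmx w) (dsubmx w)).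
Qed.

End Realification.

(** The modulus of [c] is a nonnegative root of 1, hence 1, and so the inverse of [c] is its
    conjugate. *)
Lemma root_neg1 (C : numClosedFieldType) (m : nat) :
  exists c : C, c ^+ m.+1 = -1 /\ c^-1 = (c^*)%R.
Proof.
have cX := @rootCK C m.+1 isT (-1).
exists (m.+1.-root (-1)); split=> //.
have n1 : `|m.+1.-root (-1 : C)| = 1.
  by apply/eqP; rewrite -(@pexpr_eq1 _ _ m.+1) // -normrX cX normrN1.
by rewrite invC_norm n1 expr1n invr1 mul1r.
Qed.

Theorem theorem4p2 (R : realType) (m n : nat) (hm : (3 <= m)%N) (hn : (2 <= n)%N)
    (Psi : tensor R[i] m n) (hPsi : symmetric_tensor Psi) :
  exists T : tensor R m (n + n),
    [/\ symmetric_tensor T,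
        (forall lam : R[i], Q_eigenvalue Psi lam <-> Z_eigenvalue T lam),
        (forall (lam : R[i]) (x y : 'cV[R]_n),
           Q_eigenpair Psi lam (complex_col x y) <->
           Z_eigenpair T lam (col_mx x y)),
        (forall lam : R[i],
           E_eigenvalue (complexify T) lam -> E_eigenvalue (complexify T) (- lam))
      & (forall lam : R[i], Z_eigenvalue T lam -> Z_eigenvalue T (- lam))].
Proof.
case: m hm Psi hPsi => // m _ Psi symPsi.
have [c [cX cV]] := root_neg1 R[i] m.
exists (realify Psi); split.
- exact: symmetric_realify.
- exact: Q_eigenvalue_realify.
- exact: Z_eigenpair_realify.
- move=> lam [w]; rewrite -[w]vsubmxK => /E_eigenpair_realify.
  (* The rescaled vectors are generalized to arbitrary [u] and [v], then turned back into
     coordinates. *)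
  move/(paired_eigen_opp cX); move: (c *: _) (c^-1 *: _) => u v.
  have [x [y [-> ->]]] := paired_coordinates u v.
  by move/E_eigenpair_realify; exists (col_mx x y).
move=> lam /Q_eigenvalue_realify[z Qz]; apply/Q_eigenvalue_realify.
(* [Qz] is by definition a [paired_eigen] whose second vector is the conjugate of [z]; by [cV],
   scaling that vector by [c^-1] gives the conjugate of [c *: z]. *)
exists (c *: z); have := paired_eigen_opp cX Qz.
by rewrite /Q_eigenpair map_mxZ cV.
Qed.
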